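(* Let $F$ be any field. Every $3$-dimensional nilpotent associative algebra over $F$ is isomorphic to one of the following: $$A_{3,1}=\langle a,b,c\mid\ \rangle,\qquad A_{3,2}=\langle a,b,c\mid a^2=b\rangle,$$ $$A_{3,3}^\delta=\langle a,b,c\mid a^2=c,\ b^2=\delta c\rangle\ (\delta\in F^* ),\qquad A_{3,4}^\delta=\langle a,b,c\mid a^2=c,\ b^2=\delta c,\ ab=c\rangle\ (\delta\in F),$$ $$A_{3,5}=\langle a,b,c\mid ab=c,\ ba=-c\rangle,\qquad A_{3,6}=\langle a,b,c\mid a^2=b,\ ab=ba=c\rangle.$$ The only isomorphisms between these algebras (with distinct names or parameters) are $A_{3,3}^\delta\cong A_{3,3}^\epsilon$, which holds if and only if there is $y\in F^*$ with $\delta=y^2\epsilon$. In particular, over an infinite field there are infinitely many isomorphism classes of $3$-dimensional nilpotent associative algebras, whereas over the finite field $\mathbb{F}_q$ there are $q+6$ of them if $q$ is odd and $q+5$ if $q$ is even.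
   Context: Algebras are associative algebras over $F$, not assumed unital; an algebra $A$ is nilpotent if all products of $n$ elements vanish for some $n$. $F^*=F\setminus\{0\}$. Notation: $\langle a,b,c\mid\text{relations}\rangle$ denotes the algebra with vector space basis $a,b,c$ whose multiplication is determined by the listed products of basis elements, all products of basis elements not listed being zero. *)

(* Defs.v *)
From HB Require Import structures.
From mathcomp Require Import all_boot all_algebra ring.

Set Implicit Arguments.
Unset Strict Implicit.
Unset Printing Implicit Defensive.

Import GRing.Theory.
Local Open Scope ring_scope.

(* Finite-dimensional associative algebras over F, not assumed unital; MathComp's
   own algebra structures (lalgType, algType, falgType) all have a unit. *)
HB.mixin Record Vector_isAssocAlg (F : fieldType) A of Vector F A := {
  amul : A -> A -> A;
  amulA : associative amul;
  amul_linearl : forall y, linear (amul^~ y);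
  amul_linearr : forall x, linear (amul x)
}.

#[short(type="assocAlgType")]
HB.structure Definition AssocAlg (F : fieldType) :=
  { A of Vector F A & Vector_isAssocAlg F A }.

Section AlgebraNotions.
Variable F : fieldType.

(* All products x1 x2 ... x_(n+1) vanish for some n; the bracketing is
   irrelevant by associativity. *)
Definition nilpotent_alg (A : assocAlgType F) : Prop :=
  exists n, forall (x : A) (s : n.-tuple A), foldl amul x s = 0.

Definition isomorphic_alg (A B : assocAlgType F) : Prop :=
  exists f : {linear A -> B}, bijective f /\ {morph f : x y / amul x y}.

Definition is_nil3 (A : assocAlgType F) : Prop :=
  \dim {:A} = 3%N /\ nilpotent_alg A.

(* A family of pairwise non-isomorphic 3-dimensional nilpotent algebras, i.e. of
   representatives of distinct isomorphism classes. The type assocAlgType F is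
   too large for MathComp-Analysis sets, so classes are counted through
   representatives. *)
Definition distinct_nil3_classes (I : Type) (R : I -> assocAlgType F) : Prop :=
  (forall i, is_nil3 (R i)) /\
  (forall i j, isomorphic_alg (R i) (R j) -> i = j).

Definition infinitely_many_nil3_classes : Prop :=
  exists R : nat -> assocAlgType F, distinct_nil3_classes R.

Definition number_of_nil3_classes (n : nat) : Prop :=
  exists R : 'I_n -> assocAlgType F,
    distinct_nil3_classes R /\
    (forall A, is_nil3 A -> exists i, isomorphic_alg A (R i)).

End AlgebraNotions.

(* Bilinear multiplication on F^3 determined by a list of products of basis
   elements: an entry (i, j, v) stands for the relation e_i e_j = v, and the
   products of basis elements that are not listed are zero. *)
Section Presentation.
Variable F : fieldType.
Implicit Types (s : seq ('I_3 * 'I_3 * 'rV[F]_3)) (x y z : 'rV[F]_3).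

Definition pmul s x y : 'rV[F]_3 :=
  \sum_(r <- s) (x 0 r.1.1 * y 0 r.1.2) *: r.2.

Lemma pmul_linearl s y : linear ((pmul s)^~ y).
Proof.
move=> k u v; rewrite /pmul scaler_sumr -big_split /=; apply: eq_bigr => r _.
by rewrite !mxE mulrDl scalerDl scalerA mulrA.
Qed.

Lemma pmul_linearr s x : linear (pmul s x).
Proof.
move=> k u v; rewrite /pmul scaler_sumr -big_split /=; apply: eq_bigr => r _.
by rewrite !mxE mulrDr scalerDl scalerA mulrCA.
Qed.

Definition presented s of associative (pmul s) : Type := 'rV[F]_3.

HB.instance Definition _ s (sA : associative (pmul s)) :=
  Vector.copy (presented sA) 'rV[F]_3.

HB.instance Definition _ s (sA : associative (pmul s)) :=
  Vector_isAssocAlg.Build F (presented sA) sA (pmul_linearl s) (pmul_linearr s).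

Local Notation ia := (0 : 'I_3).
Local Notation ib := (1 : 'I_3).
Local Notation b := (delta_mx 0 1 : 'rV[F]_3).
Local Notation c := (delta_mx 0 2 : 'rV[F]_3).

Definition rel31 : seq ('I_3 * 'I_3 * 'rV[F]_3) := [::].
Definition rel32 := [:: (ia, ia, b)].
Definition rel33 (d : F) := [:: (ia, ia, c); (ib, ib, d *: c)].
Definition rel34 (d : F) := [:: (ia, ia, c); (ib, ib, d *: c); (ia, ib, c)].
Definition rel35 := [:: (ia, ib, c); (ib, ia, - c)].
Definition rel36 := [:: (ia, ia, b); (ia, ib, c); (ib, ia, c)].

Ltac prove_pmulA :=
  move=> x y z; rewrite /pmul ?big_cons !big_nil /=;
  apply/rowP; case=> [[|[|[|?]]] // ?]; rewrite !mxE /=; ring.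

Lemma pmulA31 : associative (pmul rel31). Proof. prove_pmulA. Qed.
Lemma pmulA32 : associative (pmul rel32). Proof. prove_pmulA. Qed.
Lemma pmulA33 d : associative (pmul (rel33 d)). Proof. prove_pmulA. Qed.
Lemma pmulA34 d : associative (pmul (rel34 d)). Proof. prove_pmulA. Qed.
Lemma pmulA35 : associative (pmul rel35). Proof. prove_pmulA. Qed.
Lemma pmulA36 : associative (pmul rel36). Proof. prove_pmulA. Qed.

Definition A31 : assocAlgType F := presented pmulA31.
Definition A32 : assocAlgType F := presented pmulA32.
Definition A33 (d : F) : assocAlgType F := presented (pmulA33 d).
Definition A34 (d : F) : assocAlgType F := presented (pmulA34 d).
Definition A35 : assocAlgType F := presented pmulA35.
Definition A36 : assocAlgType F := presented pmulA36.

(* Names with parameters of the listed algebras; the parameter of the third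
   family ranges over F^*, that of the fourth over F. *)
Inductive nil3_name :=
| N31 | N32 | N33 (d : F) of d != 0 | N34 of F | N35 | N36.

Definition nil3_alg (l : nil3_name) : assocAlgType F :=
  match l with
  | N31 => A31
  | N32 => A32
  | N33 d _ => A33 d
  | N34 d => A34 d
  | N35 => A35
  | N36 => A36
  end.

End Presentation.

Arguments N31 {F}.
Arguments N32 {F}.
Arguments N35 {F}.
Arguments N36 {F}.

(* Main.v *)
From HB Require Import structures.
Require Import Defs.
From mathcomp Require Import all_boot all_algebra.
From mathcomp Require Import boolp classical_sets functions cardinality.
From mathcomp Require Import finmap solvable.cyclic ring.

Set Implicit Arguments.
Unset Strict Implicit.
Unset Printing Implicit Defensive.

Import GRing.Theory.
Local Open Scope ring_scope.
Local Open Scope classical_set_scope.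
Local Open Scope card_scope.

(** Let [A] be nilpotent of dimension 3. The partial products [x], [xy], [xyz],
    ... of a nonzero product are linearly independent
    ([free_partial_products]), so products of four elements vanish. If some
    [xyz] is nonzero, then so is the cube of [x], and [x], [xx], [xxx] is a
    basis satisfying the relations of [A36].

    If all [xyz] vanish and some square [uu] does not, then every product is a
    multiple of [uu] ([products_colinear]), and the multiplication is a bilinear
    form with values in a line. Completing [u] by some [b] with [bu = 0], the
    form has matrix [[1, p], [0, d]]; according to the vanishing of [p] and [d],
    and after division of [b] by [p] if [p] is nonzero, the algebra is [A32],
    [A33] or [A34]. If all squares vanish, the multiplication is alternating and
    the algebra is [A35] or [A31].

    The six names are told apart by properties that isomorphisms preserve
    ([shape]). Within [A33], an isomorphism changes the discriminant [d] of the
    form exactly by nonzero squares; within [A34], the quotient of the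
    discriminant by the square of the alternating part is [d] itself, hence an
    invariant. Over the field with [q] elements this gives 4 classes without
    parameter, [q] classes from [A34], and one class from [A33] for every square
    class of nonzero elements. The multiplicative group being cyclic of order
    [q - 1], there are two square classes if [q] is odd and one if [q] is
    even. *)

(** * Associative algebras and their isomorphisms *)

Section AmulTheory.
Variables (F : fieldType) (A : assocAlgType F).
Implicit Types (x y z : A) (k : F).

Let lmul_lin x := GRing.isLinear.Build F A A *:%R (amul x) (amul_linearr x).
Let rmul_lin y :=
  GRing.isLinear.Build F A A *:%R (fun x => amul x y) (amul_linearl y).
Definition lmul x : {linear A -> A} := HB.pack (amul x) (lmul_lin x).
Let rmul y : {linear A -> A} := HB.pack (fun x => amul x y) (rmul_lin y).

Lemma amulDl x y z : amul (x + y) z = amul x z + amul y z.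
Proof. exact: (linearD (rmul z)). Qed.
Lemma amulDr x y z : amul x (y + z) = amul x y + amul x z.
Proof. exact: (linearD (lmul x)). Qed.
Lemma amulZl k x y : amul (k *: x) y = k *: amul x y.
Proof. exact: (linearZZ (rmul y)). Qed.
Lemma amulZr k x y : amul x (k *: y) = k *: amul x y.
Proof. exact: (linearZZ (lmul x)). Qed.
Lemma amulBl x y z : amul (x - y) z = amul x z - amul y z.
Proof. exact: (linearB (rmul z)). Qed.
Lemma amul0l x : amul 0 x = 0.
Proof. exact: (linear0 (rmul x)). Qed.

End AmulTheory.

Section Isomorphisms.
Variable F : fieldType.
Implicit Types A B C : assocAlgType F.

Lemma isomorphic_alg_sym A B : isomorphic_alg A B -> isomorphic_alg B A.
Proof.
case=> f [[g fK gK] fM].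
pose gL := GRing.isLinear.Build F B A *:%R g (can2_linear fK gK).
pose g' : {linear B -> A} := HB.pack g gL.
exists g'; split; first by exists f.
by move=> x y; apply: (can_inj fK); rewrite fM !gK.
Qed.

Lemma isomorphic_alg_trans A B C :
  isomorphic_alg A B -> isomorphic_alg B C -> isomorphic_alg A C.
Proof.
case=> f [fB fM] [g [gB gM]].
exists (g \o f : {linear A -> C}); split; first exact: bij_comp.
by move=> x y; rewrite /= fM gM.
Qed.

End Isomorphisms.

(** * Recognizing a presented algebra from a basis *)

Section Presentations.
Variable F : fieldType.
Implicit Types (A : assocAlgType F) (s : seq ('I_3 * 'I_3 * 'rV[F]_3)).
Implicit Types x y : 'rV[F]_3.

Definition comb A (a b c : A) x : A := x 0 0 *: a + x 0 1 *: b + x 0 2 *: c.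

Lemma comb_linear A (a b c : A) : linear (comb a b c).
Proof.
move=> k x y; rewrite /comb !mxE !scalerDl !scalerDr -!scalerA.
by rewrite [RHS]addrACA; congr (_ + _); rewrite addrACA.
Qed.

Lemma combE A (a b c : A) x : comb a b c x = \sum_i x 0 i *: [:: a; b; c]`_i.
Proof.
rewrite !big_ord_recl big_ord0 addr0 /comb addrA.
by do !congr (_ + _); congr (x 0 _ *: _); apply: val_inj.
Qed.

Lemma comb_bij A (a b c : A) :
  \dim {:A} = 3%N -> free [:: a; b; c] -> bijective (comb a b c).
Proof.
move=> dimA freeX; pose X := [tuple a; b; c].
have basisX : basis_of fullv X by rewrite basisEfree freeX subvf dimA.
exists (fun v => \row_i coord X i v) => [x|v].
  by apply/rowP=> i; rewrite mxE combE (coord_sum_free (X := X)).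
rewrite combE [RHS](coord_basis basisX) ?memvf //.
by apply: eq_bigr => i _; rewrite mxE.
Qed.

(** An algebra is isomorphic to a presented one as soon as some basis satisfies
    the relations: coordinates in this basis are the isomorphism. *)
Lemma isomorphic_presented A s (sA : associative (pmul s)) (a b c : A) :
  \dim {:A} = 3%N -> free [:: a; b; c] ->
  (forall x y, amul (comb a b c x) (comb a b c y) = comb a b c (pmul s x y)) ->
  isomorphic_alg A (presented sA).
Proof.
move=> dimA freeX combM; apply: isomorphic_alg_sym.
pose gL := GRing.isLinear.Build F (presented sA) A *:%R (comb a b c)
             (comb_linear a b c).
pose g : {linear presented sA -> A} :=
  HB.pack (comb a b c : presented sA -> A) gL.
by exists g; split; [exact: comb_bij | move=> x y; rewrite combM].
Qed.

Lemma amul_comb A (a b c : A) x y :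
  (forall z, amul c z = 0) -> (forall z, amul z c = 0) ->
  amul (comb a b c x) (comb a b c y) =
    (x 0 0 * y 0 0) *: amul a a + (x 0 0 * y 0 1) *: amul a b +
    ((x 0 1 * y 0 0) *: amul b a + (x 0 1 * y 0 1) *: amul b b).
Proof.
move=> cl cr; rewrite /comb !amulDl !amulDr !amulZl !amulZr !cl !cr.
by rewrite !scaler0 !addr0 !scalerA.
Qed.

Lemma comb_pmul A (a b c : A) s x y :
  comb a b c (pmul s x y) =
    \sum_(r <- s) (x 0 r.1.1 * y 0 r.1.2) *: comb a b c r.2.
Proof.
pose gL := GRing.isLinear.Build F 'rV_3 A *:%R (comb a b c) (comb_linear a b c).
pose g : {linear 'rV[F]_3 -> A} := HB.pack (comb a b c) gL.
rewrite -[LHS]/(g (pmul s x y)) /pmul linear_sum.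
by apply: eq_bigr => r _; rewrite linearZZ.
Qed.

Lemma comb_b A (a b c : A) : comb a b c (delta_mx 0 1) = b.
Proof. by rewrite /comb !mxE /= !scale0r scale1r add0r addr0. Qed.

Lemma comb_c A (a b c : A) : comb a b c (delta_mx 0 2) = c.
Proof. by rewrite /comb !mxE /= !scale0r scale1r !add0r. Qed.

Lemma comb_Z A (a b c : A) k x : comb a b c (k *: x) = k *: comb a b c x.
Proof. by rewrite /comb !mxE -!scalerA !scalerDr. Qed.

Lemma comb_N A (a b c : A) x : comb a b c (- x) = - comb a b c x.
Proof. by rewrite -scaleN1r comb_Z scaleN1r. Qed.

Section Recognize.
Variables (A : assocAlgType F) (a b c : A).
Hypotheses (dimA : \dim {:A} = 3%N) (freeX : free [:: a; b; c]).

Let combE' := (comb_pmul, big_cons, big_nil, comb_b, comb_c, comb_Z, comb_N).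

Lemma isomorphic_A31 : (forall x y : A, amul x y = 0) ->
  isomorphic_alg A (A31 F).
Proof.
move=> AA0; apply: (isomorphic_presented _ dimA freeX) => x y.
by rewrite AA0 !combE'.
Qed.

Hypotheses (cl : forall z, amul c z = 0) (cr : forall z, amul z c = 0).

Lemma isomorphic_A33 d :
  amul a a = c -> amul b b = d *: c -> amul a b = 0 -> amul b a = 0 ->
  isomorphic_alg A (A33 d).
Proof.
move=> aa bb ab ba; apply: (isomorphic_presented _ dimA freeX) => x y.
by rewrite amul_comb // aa bb ab ba !combE' /= !scaler0 !addr0 add0r.
Qed.

Lemma isomorphic_A34 d :
  amul a a = c -> amul b b = d *: c -> amul a b = c -> amul b a = 0 ->
  isomorphic_alg A (A34 d).
Proof.
move=> aa bb ab ba; apply: (isomorphic_presented _ dimA freeX) => x y.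
rewrite amul_comb // aa bb ab ba !combE' /= !scaler0 !addr0 add0r.
by rewrite -addrA [X in _ + X]addrC.
Qed.

Lemma isomorphic_A35 :
  amul a a = 0 -> amul b b = 0 -> amul a b = c -> amul b a = - c ->
  isomorphic_alg A (A35 F).
Proof.
move=> aa bb ab ba; apply: (isomorphic_presented _ dimA freeX) => x y.
by rewrite amul_comb // aa bb ab ba !combE' /= !scaler0 !addr0 add0r.
Qed.

Lemma isomorphic_A32 :
  amul a a = b -> amul a b = 0 -> amul b a = 0 -> amul b b = 0 ->
  isomorphic_alg A (A32 F).
Proof.
move=> aa ab ba bb; apply: (isomorphic_presented _ dimA freeX) => x y.
by rewrite amul_comb // aa bb ab ba !combE' /= !scaler0 !addr0.
Qed.

Lemma isomorphic_A36 :
  amul a a = b -> amul a b = c -> amul b a = c -> amul b b = 0 ->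
  isomorphic_alg A (A36 F).
Proof.
move=> aa ab ba bb; apply: (isomorphic_presented _ dimA freeX) => x y.
by rewrite amul_comb // aa bb ab ba !combE' /= !scaler0 !addr0 -!addrA.
Qed.

End Recognize.
End Presentations.

(** * Three-dimensional nilpotent algebras *)

Section Nilpotent.
Variables (F : fieldType) (A : assocAlgType F).
Hypothesis nilA : nilpotent_alg A.
Implicit Types x y z u v w : A.

(** If [x = xw] then [x = x w ^ n] for all [n]. *)
Lemma nilpotent_fixed x w : amul x w = x -> x = 0.
Proof.
case: nilA => n nA xw; rewrite -[RHS](nA x (nseq_tuple n w)) /=.
by elim: n {nA} => //= n IHn; rewrite xw.
Qed.

Lemma scanl_amul x y s :
  scanl amul (amul x y) s = map (amul x) (scanl amul y s).
Proof. by elim: s y => //= z s IHs y; rewrite -amulA IHs. Qed.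

(** A relation among the partial products [x], [xy], [xyz], ... of a nonzero
    product would express one of them, say [p], as a combination of the
    subsequent ones, all of which lie in [pA], against [nilpotent_fixed]. *)
Lemma free_partial_products x s :
  foldl amul x s != 0 -> free (x :: scanl amul x s).
Proof.
elim: s x => [|y s IHs] x /=; first by rewrite seq1_free.
move=> nz; rewrite free_cons IHs // andbT; apply/negP => xS.
have: x \in (linfun (lmul x) @: <<y :: scanl amul y s>>)%VS.
  rewrite limg_span (eq_map (lfunE (lmul x))) /=.
  by rewrite -scanl_amul.
case/memv_imgP=> w _; rewrite lfunE /= => /esym/nilpotent_fixed x0.
move/eqP: nz; apply; rewrite x0 amul0l.
by elim: s {IHs xS} => //= z s; rewrite amul0l.
Qed.

Lemma span2P u v w :
  w \in <<[:: u; v]>>%VS -> exists k l, w = k *: u + l *: v.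
Proof.
rewrite span_cons span_seq1 => /memv_addP[_ /vlineP[k ->] [_ /vlineP[l ->] ->]].
by exists k, l.
Qed.

Hypothesis dimA : \dim {:A} = 3%N.

Lemma combP (a b c v : A) :
  free [:: a; b; c] -> exists r, v = comb a b c r.
Proof. by case/(comb_bij dimA) => g _ gK; exists (g v). Qed.

Lemma prod4_eq0 x y z w : amul (amul (amul x y) z) w = 0.
Proof.
apply/eqP; apply: contraT => /(@free_partial_products x [:: y; z; w]) /=.
rewrite /free => /eqP dim4.
have := dimvS (subvf <<x :: scanl amul x [:: y; z; w]>>).
by rewrite dim4 dimA.
Qed.

(** If [xyz] is nonzero then [x], [xy], [xyz] is a basis, so [y] and [z] are
    multiples of [x] modulo [xA]; products of four elements being zero, [xyz]
    is a multiple of the cube of [x]. *)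
Lemma cube_neq0 x y z :
  amul (amul x y) z != 0 -> amul (amul x x) x != 0.
Proof.
move=> nz; have fX := @free_partial_products x [:: y; z] nz.
have modx v : exists k t, v = k *: x + amul x t.
  have [r ->] := combP v fX.
  exists (r 0 0), (r 0 1 *: y + r 0 2 *: amul y z).
  by rewrite amulDr !amulZr amulA /comb addrA.
have [k [t def_y]] := modx y; have [l [w def_z]] := modx z.
apply: contraNneq nz => xxx0.
rewrite def_y def_z !amulDr !amulDl !amulZr !amulZl !amulA !prod4_eq0 xxx0.
by rewrite !(amul0l, scaler0, addr0).
Qed.

Lemma classify_cube_neq0 x y z :
  amul (amul x y) z != 0 -> isomorphic_alg A (A36 F).
Proof.
move/cube_neq0 => nz; have fX := @free_partial_products x [:: x; x] nz.
apply: (isomorphic_A36 dimA fX) => *; rewrite ?amulA ?prod4_eq0 //.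
Qed.

Section CubeZero.
Hypothesis cube0 : forall x y z, amul (amul x y) z = 0.

Let cube0r x y z : amul x (amul y z) = 0.
Proof. by rewrite amulA cube0. Qed.

(** If [p = vw] were not a multiple of [uu], then [p], [u], [uu] would be a
    basis. Since [p] and [uu] annihilate the algebra, every product would be a
    multiple of [uu] after all. *)
Lemma products_colinear u v w :
  amul u u != 0 -> exists k, amul v w = k *: amul u u.
Proof.
move=> uu; have fX := @free_partial_products u [:: u] uu.
have [pS|pS] := boolP (amul v w \in <<[:: u; amul u u]>>%VS).
  have [k [l def_p]] := span2P pS; exists l.
  have: amul (amul v w) u = 0 by rewrite cube0.
  rewrite def_p amulDl !amulZl cube0 scaler0 addr0 => /eqP.
  by rewrite scaler_eq0 (negPf uu) orbF => /eqP ->; rewrite scale0r add0r.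
have fY : free [:: amul v w; u; amul u u] by rewrite free_cons pS.
have [r def_v] := combP v fY; have [s def_w] := combP w fY.
exists (r 0 1 * s 0 1); rewrite [LHS](congr2 amul def_v def_w) /comb.
rewrite !amulDr !amulDl !amulZr !amulZl !amulA !cube0.
by rewrite !(amul0l, scaler0, addr0, add0r) scalerA mulrC.
Qed.

Lemma extend_free u v : free [:: u; v] -> exists w, w \notin <<[:: u; v]>>%VS.
Proof.
rewrite /free => /eqP dim2.
suff /subvPn[w _ nw]: ~~ (fullv <= <<[:: u; v]>>)%VS by exists w.
by apply/negP => /dimvS; rewrite dim2 dimA.
Qed.

(** With [uu] nonzero, the multiplication is given by a bilinear form with
    values in the line of [uu]. As [u] is anisotropic, there is a [b] outside
    that line and the line of [u], with [bu = 0]. Whether [ub] and [bb] vanish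
    then decides between the three possibilities, up to rescaling [b]. *)
Lemma classify_square_neq0 u :
  amul u u != 0 -> exists l, isomorphic_alg A (@nil3_alg F l).
Proof.
move=> uu; have fX := @free_partial_products u [:: u] uu; rewrite /= in fX.
have [e eS] := extend_free fX; have [k def_k] := products_colinear e u uu.
have [b [bS bu]] : exists b, b \notin <<[:: u; amul u u]>>%VS /\ amul b u = 0.
  exists (e - k *: u); split; last by rewrite amulBl amulZl def_k subrr.
  by rewrite (@rpredBr _ _ (k *: u) e) // rpredZ // memv_span // mem_head.
have [p def_p] := products_colinear u b uu.
have [d def_d] := products_colinear b b uu.
have perm3 b' : free [:: b'; u; amul u u] = free [:: u; b'; amul u u].
  by apply: perm_free; rewrite (perm_catCA [:: b'] [:: u] [:: amul u u]).
have [p0|p0] := eqVneq p 0; last first.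
  exists (N34 (d / p ^+ 2)); apply: (@isomorphic_A34 _ _ u (p^-1 *: b)) => //.
  - by rewrite -perm3 free_cons rpredZeq invr_eq0 (negPf p0) bS.
  - by rewrite amulZl amulZr def_d !scalerA; congr (_ *: _); field.
  - by rewrite amulZr def_p scalerA mulVf // scale1r.
  - by rewrite amulZl bu scaler0.
rewrite p0 scale0r in def_p; have [d0|d0] := eqVneq d 0; last first.
  exists (N33 d0); apply: (@isomorphic_A33 _ _ u b) => //.
  by rewrite -perm3 free_cons bS.
rewrite d0 scale0r in def_d; exists N32.
(* The basis of the presentation lists the square second, so [b], which now
   annihilates the algebra, comes last. *)
have fY : free [:: u; amul u u; b].
  have /perm_free <- : perm_eq [:: b; u; amul u u] [:: u; amul u u; b].
    by rewrite (perm_catC [:: b] [:: u; amul u u]).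
  by rewrite free_cons bS.
have annb z : amul b z = 0 /\ amul z b = 0.
  have [r ->] := combP z fY.
  rewrite /comb !amulDl !amulDr !amulZl !amulZr bu def_p def_d cube0 cube0r.
  by rewrite !scaler0 !addr0.
by apply: (isomorphic_A32 dimA fY) => // z; have [] := annb z.
Qed.

Lemma classify_squares_eq0 u v :
  (forall z, amul z z = 0) -> amul u v != 0 -> isomorphic_alg A (A35 F).
Proof.
move=> sq0 uv.
(* Polarization of the vanishing squares. *)
have vu : amul v u = - amul u v.
  apply/eqP; rewrite -addr_eq0; apply/eqP.
  by rewrite -(sq0 (u + v)) amulDl !amulDr !sq0 add0r addr0 addrC.
have fvc : free [:: v; amul u v].
  have := @free_partial_products v [:: - u].
  by rewrite /= -scaleN1r amulZr scaleN1r vu opprK => ->.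
have fX : free [:: u; v; amul u v].
  rewrite free_cons fvc andbT; apply: contra uv => /span2P[k [l {1}->]].
  by rewrite amulDl !amulZl sq0 cube0 !scaler0 addr0.
by apply: (isomorphic_A35 dimA fX).
Qed.

End CubeZero.
End Nilpotent.

Section Classification.
Variable F : fieldType.

Lemma nil3_classification (A : assocAlgType F) :
  is_nil3 A -> exists l : nil3_name F, isomorphic_alg A (nil3_alg l).
Proof.
case=> dimA nilA.
have [[x [y [z xyz]]]|/forallNP cubeN] :=
  pselect (exists x y z : A, amul (amul x y) z != 0).
  by exists N36; apply: classify_cube_neq0 xyz.
have cube0 (x y z : A) : amul (amul x y) z = 0.
  by apply/eqP/negPn/negP => nz; apply: (cubeN x); exists y, z.
have [[u uu]|/forallNP sqN] := pselect (exists u : A, amul u u != 0).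
  exact: classify_square_neq0 uu.
have sq0 (u : A) : amul u u = 0 by apply/eqP/negPn/negP; apply: sqN.
have [[u [v uv]]|/forallNP mulN] := pselect (exists u v : A, amul u v != 0).
  by exists N35; apply: classify_squares_eq0 uv.
exists N31; have [X fX] : exists X : 3.-tuple A, free X.
  move: (vbasis {:A}) (vbasisP {:A}); rewrite dimA => X /basis_free fX.
  by exists X.
case/tupleP: X fX => a X; case/tupleP: X => b X; case/tupleP: X => c X.
rewrite tuple0 /= => fX; apply: (isomorphic_A31 dimA fX) => u v.
by apply/eqP/negPn/negP => nz; apply: (mulN u); exists v.
Qed.

End Classification.

(** * Invariants of the listed algebras *)

Section Invariants.
Variable F : fieldType.
Implicit Types (A B : assocAlgType F) (x y z : 'rV[F]_3) (d e : F).

Local Notation ea := (delta_mx 0 0 : 'rV[F]_3).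
Local Notation eb := (delta_mx 0 1 : 'rV[F]_3).
Local Notation ec := (delta_mx 0 2 : 'rV[F]_3).

Lemma pmul32E x y : pmul (rel32 F) x y = (x 0 0 * y 0 0) *: eb.
Proof. by rewrite /pmul big_cons big_nil addr0. Qed.

Lemma pmul33E d x y :
  pmul (rel33 d) x y = (x 0 0 * y 0 0 + d * (x 0 1 * y 0 1)) *: ec.
Proof.
by rewrite /pmul !big_cons big_nil addr0 /= scalerDl scalerA [d * _]mulrC.
Qed.

Lemma pmul34E d x y :
  pmul (rel34 d) x y =
    (x 0 0 * y 0 0 + d * (x 0 1 * y 0 1) + x 0 0 * y 0 1) *: ec.
Proof.
rewrite /pmul !big_cons big_nil addr0 /= !scalerDl scalerA addrA.
by rewrite [d * _]mulrC.
Qed.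

Lemma pmul35E x y :
  pmul (rel35 F) x y = (x 0 0 * y 0 1 - x 0 1 * y 0 0) *: ec.
Proof. by rewrite /pmul !big_cons big_nil addr0 /= scalerN scalerBl. Qed.

Lemma pmul36E x y :
  pmul (rel36 F) x y =
    (x 0 0 * y 0 0) *: eb + (x 0 0 * y 0 1 + x 0 1 * y 0 0) *: ec.
Proof. by rewrite /pmul !big_cons big_nil addr0 /= scalerDl. Qed.

Lemma nil3_alg_is_nil3 (l : nil3_name F) : is_nil3 (nil3_alg l).
Proof.
split; first by case: l => *; rewrite dimvf dim_matrix.
exists 3%N => x [[|y [|z [|w []]]]] //= _.
case: l x y z w => [||d d0|d||] x y z w.
- exact: big_nil.
- rewrite -[LHS]/(pmul _ (pmul _ (pmul _ x y) z) w) !pmul32E !mxE /=.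
  by rewrite !(mulr0, mul0r, scale0r).
- rewrite -[LHS]/(pmul _ (pmul _ (pmul _ x y) z) w) !pmul33E !mxE /=.
  by rewrite !(mulr0, mul0r, addr0, scale0r).
- rewrite -[LHS]/(pmul _ (pmul _ (pmul _ x y) z) w) !pmul34E !mxE /=.
  by rewrite !(mulr0, mul0r, addr0, scale0r).
- rewrite -[LHS]/(pmul _ (pmul _ (pmul _ x y) z) w) !pmul35E !mxE /=.
  by rewrite !(mulr0, mul0r, subr0, scale0r).
- rewrite -[LHS]/(pmul _ (pmul _ (pmul _ x y) z) w) !pmul36E !mxE /=.
  by rewrite !(mulr0, mul0r, addr0, scale0r).
Qed.

Definition null_alg A := forall x y : A, amul x y = 0.
Definition alternating_alg A := forall x : A, amul x x = 0.
Definition commutative_alg A := commutative (@amul F A).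
Definition null_cube A := forall x y z : A, amul (amul x y) z = 0.
(** Of two vectors orthogonal for a symmetric form of rank 1, one is isotropic;
    an orthogonal basis of a nondegenerate form contradicts this. *)
Definition isotropic_pairs A :=
  forall x y : A, amul x y = 0 -> amul x x = 0 \/ amul y y = 0.

(** The number of the name in the list, found by testing properties in an order
    for which each answer is the same over every field: whether [A35] is
    commutative, for instance, depends on the characteristic, so that
    alternating algebras are singled out before. *)
Definition shape A : nat :=
  if `[< null_alg A >] then 1
  else if `[< alternating_alg A >] then 5
  else if ~~ `[< commutative_alg A >] then 4
  else if ~~ `[< null_cube A >] then 6
  else if `[< isotropic_pairs A >] then 2 else 3.

Lemma shape_isomorphic A B : isomorphic_alg A B -> shape A = shape B.
Proof.
have transfer (P : assocAlgType F -> Prop) :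
    (forall A B, isomorphic_alg A B -> P B -> P A) ->
    isomorphic_alg A B -> `[< P A >] = `[< P B >].
  move=> PBA AB; apply: asbool_equiv_eq.
  by split; [apply/PBA/isomorphic_alg_sym | apply: PBA].
move=> AB; rewrite /shape (transfer null_alg) // 1?(transfer alternating_alg) //
  1?(transfer commutative_alg) // 1?(transfer null_cube) //
  1?(transfer isotropic_pairs) //.
- move=> {A B AB transfer} A B [f [[g fK gK] fM]] PB x y.
  move/(congr1 f); rewrite fM linear0 => /PB; rewrite -!fM.
  by case=> xx; [left|right]; apply: (can_inj fK); rewrite xx linear0.
- move=> {A B AB transfer} A B [f [[g fK gK] fM]] PB x y z.
  by apply: (can_inj fK); rewrite !fM PB linear0.
- move=> {A B AB transfer} A B [f [[g fK gK] fM]] PB x y.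
  by apply: (can_inj fK); rewrite !fM PB.
- move=> {A B AB transfer} A B [f [[g fK gK] fM]] PB x.
  by apply: (can_inj fK); rewrite !fM PB linear0.
- move=> {A B AB transfer} A B [f [[g fK gK] fM]] PB x y.
  by apply: (can_inj fK); rewrite !fM PB linear0.
Qed.

Lemma shape_nil3 (l : nil3_name F) :
  shape (nil3_alg l) =
    match l with N31 => 1 | N32 => 2 | N33 _ _ => 3 | N34 _ => 4 | N35 => 5
    | N36 => 6 end%N.
Proof.
have injb k k' : k *: eb = k' *: eb -> k = k'.
  by move/(congr1 (fun v : 'rV_3 => v 0 1)); rewrite !mxE /= !mulr1.
have injc k k' : k *: ec = k' *: ec -> k = k'.
  by move/(congr1 (fun v : 'rV_3 => v 0 2)); rewrite !mxE /= !mulr1.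
have nzb k : k *: eb = 0 -> k = 0 by move=> k0; apply: injb; rewrite scale0r.
have nzc k : k *: ec = 0 -> k = 0 by move=> k0; apply: injc; rewrite scale0r.
have absurd1 : (1 : F) <> 0 by move/eqP; rewrite oner_eq0.
have not_alternating A : ~ alternating_alg A -> `[< null_alg A >] = false.
  by move=> altF; apply: asboolF => nullA; apply: altF => x; apply: nullA.
have mxs := (mxE, mulr1, mul1r, mulr0, mul0r, addr0, add0r, subr0, sub0r).
rewrite /shape; case: l => [||d d0|d||].
- by rewrite asboolT // => x y; apply: big_nil.
- have altF : ~ alternating_alg (A32 F).
    move/(_ ea); rewrite -[LHS]/(pmul _ _ _) pmul32E => /nzb.
    by rewrite !mxs.
  rewrite not_alternating // asboolF // asboolT /= => [|x y]; last first.
    by rewrite -[LHS]/(pmul _ _ _) -[RHS]/(pmul _ _ _) !pmul32E mulrC.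
  rewrite asboolT /= => [|x y z]; last first.
    by rewrite -[LHS]/(pmul _ (pmul _ _ _) _) !pmul32E !mxs scale0r.
  rewrite asboolT // => x y; rewrite -[LHS]/(pmul _ _ _) pmul32E.
  move=> /nzb/eqP; rewrite mulf_eq0.
  by case/orP=> /eqP xy0; [left | right];
    rewrite -[LHS]/(pmul _ _ _) pmul32E xy0 mulr0 scale0r.
- have altF : ~ alternating_alg (A33 d).
    move/(_ ea); rewrite -[LHS]/(pmul _ _ _) pmul33E => /nzc.
    by rewrite !mxs.
  rewrite not_alternating // asboolF // asboolT /= => [|x y]; last first.
    rewrite -[LHS]/(pmul _ _ _) -[RHS]/(pmul _ _ _) !pmul33E.
    by rewrite mulrC [x 0 1 * _]mulrC.
  rewrite asboolT /= => [|x y z]; last first.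
    by rewrite -[LHS]/(pmul _ (pmul _ _ _) _) !pmul33E !mxs scale0r.
  rewrite asboolF // => /(_ ea eb); rewrite -![amul _ _]/(pmul _ _ _) !pmul33E.
  rewrite !mxs scale0r => /(_ erefl)[/nzc //|/nzc /eqP].
  by rewrite (negPf d0).
- have altF : ~ alternating_alg (A34 d).
    move/(_ ea); rewrite -[LHS]/(pmul _ _ _) pmul34E => /nzc.
    by rewrite !mxs.
  rewrite not_alternating // asboolF // asboolF // => /(_ ea eb).
  rewrite -[LHS]/(pmul _ _ _) -[RHS]/(pmul _ _ _) !pmul34E => /injc.
  by rewrite !mxs.
- rewrite asboolF => [|/(_ ea eb)]; last first.
    by rewrite -[LHS]/(pmul _ _ _) pmul35E => /nzc; rewrite !mxs.
  rewrite asboolT // => x.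
  by rewrite -[LHS]/(pmul _ _ _) pmul35E mulrC subrr scale0r.
- have altF : ~ alternating_alg (A36 F).
    move/(_ ea); rewrite -[LHS]/(pmul _ _ _) pmul36E !mxs scale0r addr0 => /nzb.
    by [].
  rewrite not_alternating // asboolF // asboolT /= => [|x y]; last first.
    rewrite -[LHS]/(pmul _ _ _) -[RHS]/(pmul _ _ _) !pmul36E.
    by congr (_ *: _ + _ *: _); ring.
  rewrite asboolF // => /(_ ea ea ea).
  rewrite -[LHS]/(pmul _ (pmul _ _ _) _) !pmul36E !mxs !scale0r add0r => /nzc.
  by [].
Qed.

End Invariants.

(** * Isomorphisms within the two families *)

Section Families.
Variable F : fieldType.
Implicit Types (x y : 'rV[F]_3) (d e : F).

Local Notation ea := (delta_mx 0 0 : 'rV[F]_3).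
Local Notation eb := (delta_mx 0 1 : 'rV[F]_3).
Local Notation ec := (delta_mx 0 2 : 'rV[F]_3).

(** When all products lie in one line, an isomorphism is an equivalence of the
    bilinear forms up to the factor by which it scales this line. *)
Lemma isomorphic_forms s t
    (sA : associative (pmul s)) (tA : associative (pmul t))
    (B C : 'rV[F]_3 -> 'rV[F]_3 -> F) :
  (forall x y, pmul s x y = B x y *: ec) ->
  (forall x y, pmul t x y = C x y *: ec) ->
  B ea ea != 0 -> isomorphic_alg (presented sA) (presented tA) ->
  exists f r, r != 0 /\ forall x y, C (f x) (f y) = r * B x y.
Proof.
move=> sE tE B0 [f [[g fK _] fM]]; pose c : 'rV[F]_3 := f ec.
have fMc x y : C (f x) (f y) *: ec = B x y *: c.
  by rewrite -tE -linearZZ -sE -[LHS]fM.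
have fMr x y : C (f x) (f y) = c 0 2 * B x y.
  by move/rowP/(_ 2): (fMc x y); rewrite !mxE mulr1 mulrC.
exists f, (c 0 2); split=> //; apply/negP => /eqP r0.
have c0 : B ea ea *: c = 0 by rewrite -fMc fMr r0 mul0r scale0r.
have: ec = 0.
  apply: (can_inj fK); rewrite linear0; apply/eqP; move/eqP: c0.
  by rewrite scaler_eq0 (negPf B0).
by move/rowP/(_ 2)/eqP; rewrite !mxE oner_eq0.
Qed.

(** On the images of the first two basis vectors, the second form has Gram
    determinant [r ^+ 2 * d], which is also [e] times the square of a
    determinant. *)
Lemma A33_isomorphic_square d e :
  d != 0 -> isomorphic_alg (A33 d) (A33 e) ->
  exists2 y, y != 0 & d = y ^+ 2 * e.
Proof.
move=> d0 /(isomorphic_forms (pmul33E d) (pmul33E e)) [|f [r [r0 fE]]].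
  by rewrite !mxE mulr1 mulr0 mulr0 addr0 oner_eq0.
move: (fE ea ea) (fE ea eb) (fE eb eb); set p := f ea; set q := f eb.
rewrite !mxE /= !(mulr1, mulr0, mul0r, addr0, add0r) => pp pq qq.
pose D := p 0 0 * q 0 1 - p 0 1 * q 0 0.
have def_d : d = (D / r) ^+ 2 * e.
  suff: r ^+ 2 * d = D ^+ 2 * e.
    by move=> rdE; apply: (mulfI (expf_neq0 2 r0)); rewrite rdE; field.
  (* The determinant of the Gram matrix of [p] and [q]. *)
  transitivity (r * (r * d) - 0 ^+ 2); first by ring.
  by rewrite -{1}pp -qq -pq /D; ring.
exists (D / r) => //; apply: contraNneq d0 => D0.
by rewrite def_d D0 expr0n mul0r.
Qed.

(** The discriminant and the square of the alternating part of the form are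
    multiplied by the same factor, so that their quotient is an invariant. *)
Lemma A34_isomorphic_eq d e : isomorphic_alg (A34 d) (A34 e) -> d = e.
Proof.
move=> /(isomorphic_forms (pmul34E d) (pmul34E e)) [|f [r [r0 fE]]].
  by rewrite !mxE mulr1 !mulr0 !addr0 oner_eq0.
move: (fE ea ea) (fE ea eb) (fE eb ea) (fE eb eb); set p := f ea; set q := f eb.
rewrite !mxE /= !(mulr1, mulr0, mul0r, addr0, add0r) => pp pq qp qq.
pose D := p 0 0 * q 0 1 - p 0 1 * q 0 0.
(* The alternating part of the form takes the value [D] on [p] and [q]. *)
have def_r : r = D by rewrite -[LHS]subr0 -{1}pq -qp /D; ring.
apply: (mulfI (expf_neq0 2 r0)).
transitivity (r * (r * d) - r * 0); first by ring.
by rewrite -{1}pp -qq -{1}pq -qp def_r /D; ring.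
Qed.

(** Dividing [b] by [t] divides its square by [t ^+ 2]. *)
Lemma A33_isomorphic d t e :
  d != 0 -> t != 0 -> d = t ^+ 2 * e -> isomorphic_alg (A33 d) (A33 e).
Proof.
move=> d0 t0 def_d; have [dimA _] := nil3_alg_is_nil3 (N33 d0).
have annl (z : A33 d) : amul (ec : A33 d) z = 0.
  by rewrite -[LHS]/(pmul _ _ _) pmul33E !mxE /= !mul0r mulr0 addr0 scale0r.
have annr (z : A33 d) : amul z (ec : A33 d) = 0.
  by rewrite -[LHS]/(pmul _ _ _) pmul33E !mxE /= !mulr0 addr0 scale0r.
apply: (@isomorphic_A33 _ (A33 d)
          (ea : A33 d) (t^-1 *: eb : 'rV_3) (ec : A33 d));
  rewrite // -?[LHS]/(pmul _ _ _) ?pmul33E.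
- pose X := [tuple (ea : A33 d); t^-1 *: eb : 'rV_3; (ec : A33 d)].
  apply: (introT (freeP (X := X))) => k k0.
  have: comb (ea : A33 d) (t^-1 *: eb : 'rV_3) (ec : A33 d) (\row_i k i) = 0.
    by rewrite combE -[RHS]k0; apply: eq_bigr => i _; rewrite mxE.
  move/rowP => kE i; move: (kE i); rewrite !mxE.
  case: i => [[|[|[|//]]] lt_i] /=; rewrite !(mulr0, mulr1, addr0, add0r).
  + by move=> <-; congr k; apply: val_inj.
  + move/eqP; rewrite mulf_eq0 invr_eq0 (negPf t0) orbF => /eqP <-.
    by congr k; apply: val_inj.
  + by move=> <-; congr k; apply: val_inj.
- by rewrite !mxE /= !(mulr1, mulr0, mul0r, addr0) scale1r.
- rewrite !mxE /= !(mulr1, mulr0, mul0r, add0r); congr (_ *: _).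
  by rewrite def_d; field.
- by rewrite !mxE /= !(mulr1, mulr0, mul0r, addr0, add0r) scale0r.
- by rewrite !mxE /= !(mulr1, mulr0, mul0r, addr0, add0r) scale0r.
Qed.

End Families.

(** * Counting isomorphism classes *)

Section Counting.
Variable F : fieldType.

Lemma nil3_isomorphic_names (l l' : nil3_name F) : l <> l' ->
  isomorphic_alg (nil3_alg l) (nil3_alg l') ->
  exists (d e : F) (hd : d != 0) (he : e != 0), l = N33 hd /\ l' = N33 he.
Proof.
move=> neq iso; have := shape_isomorphic iso; rewrite !shape_nil3.
case: l l' neq iso => [||d hd|d||] [||e he|e||] //= neq iso _.
  by exists d, e, hd, he.
by case: neq; rewrite (A34_isomorphic_eq iso).
Qed.

Section FiniteField.
Variable q : nat.
Hypothesis cardF : [set: F] #= `I_q.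

Lemma finite_field_enum :
  exists s : seq F, [/\ uniq s, size s = q & s =i predT].
Proof.
exists (fset_set [set: F]); split.
- exact: fset_uniq.
- exact: card_fset_set.
- move=> x; rewrite in_fset_set ?in_setT //; by exists q.
Qed.

(** Multiplication by a nonzero [x] permutes the nonzero elements, whose product
    is thus unchanged when multiplied by [x ^+ q.-1]; hence they are all
    [q.-1]-th roots of unity. *)
Lemma finite_field_generator :
  exists2 z : F, q.-1.-primitive_root z &
    forall x, x != 0 -> exists i, x = z ^+ i.
Proof.
have [s [us sz_s all_s]] := finite_field_enum.
pose r : seq F := rem 0 s; have ur : uniq r by apply: rem_uniq.
have mem_r (x : F) : (x \in r) = (x != 0).
  by rewrite mem_rem_uniq // inE all_s andbT.
have sz_r : size r = q.-1 by rewrite size_rem ?all_s ?sz_s.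
have root1 (x : F) : x != 0 -> x ^+ q.-1 = 1.
  move=> x0; have perm_xr : perm_eq r (map ( *%R x) r).
    apply: uniq_perm => //; first by rewrite map_inj_uniq //; apply: mulfI.
    move=> y; rewrite mem_r; apply/idP/mapP => [y0|[w]].
      exists (y / x); last by rewrite mulrC divfK.
      by rewrite mem_r mulf_neq0 ?invr_eq0.
    by rewrite mem_r => w0 ->; rewrite mulf_neq0.
  have prod_r : \prod_(y <- r) y != 0.
    by rewrite prodf_seq_neq0; apply/allP => y; rewrite mem_r.
  apply: (mulIf prod_r); rewrite mul1r [RHS](perm_big _ perm_xr) big_map.
  by rewrite big_split big_const_seq count_predT sz_r iter_mulr_1.
have n_gt0 : (0 < q.-1)%N.
  by rewrite -sz_r -has_predT; apply/hasP; exists 1; rewrite // mem_r oner_eq0.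
have /hasP[z _ prim_z] : has q.-1.-primitive_root r.
  apply: has_prim_root => //; last by rewrite sz_r.
  by apply/allP => x; rewrite mem_r unity_rootE => /root1 ->.
by exists z => // x /root1/(prim_rootP prim_z)[i ->]; exists i.
Qed.

(** [N34] contributes one class for each element of the field, [N33] one for
    each square class of nonzero elements, of which the [u i] are
    representatives. *)
Lemma number_of_nil3_classes_square_classes m (u : 'I_m -> F) :
  (forall i, u i != 0) ->
  (forall i j t, u i = t ^+ 2 * u j -> i = j) ->
  (forall d : F, d != 0 -> exists i (t : F), t != 0 /\ d = t ^+ 2 * u i) ->
  number_of_nil3_classes F (q + (m + 4)).
Proof.
move=> u0 u_inj u_surj; have [s [us sz_s all_s]] := finite_field_enum.
(* The four names without parameter come last. *)
pose name (i : 'I_q + ('I_m + 'I_4)) : nil3_name F :=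
  match i with
  | inl i => N34 s`_i
  | inr (inl i) => N33 (u0 i)
  | inr (inr i) => nth N31 [:: N31; N32; N35; N36] i
  end.
pose index (i : 'I_(q + (m + 4))) : 'I_q + ('I_m + 'I_4) :=
  match fintype.split i with
  | inl i => inl i
  | inr i => inr (fintype.split i)
  end.
pose unindex (i : 'I_q + ('I_m + 'I_4)) : 'I_(q + (m + 4)) :=
  unsplit (match i with inl i => inl i | inr i => inr (unsplit i) end).
have indexK : cancel index unindex.
  move=> i; rewrite /index /unindex -[RHS]splitK.
  by case: (fintype.split i) => // j; rewrite splitK.
have unindexK : cancel unindex index.
  by rewrite /index => -[i|i]; rewrite unsplitK ?unsplitK.
have name_inj i j :
    isomorphic_alg (nil3_alg (name i)) (nil3_alg (name j)) -> i = j.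
  move=> iso; have := shape_isomorphic iso; rewrite !shape_nil3.
  case: i j iso => [i|[i|[[|[|[|[|//]]]] lt_i]]]
                   [j|[j|[[|[|[|[|//]]]] lt_j]]] //= iso _.
  - move/A34_isomorphic_eq/eqP: iso; rewrite nth_uniq ?sz_s // => /eqP ij.
    by congr inl; apply: val_inj.
  - by have [t _ /u_inj ->] := A33_isomorphic_square (u0 i) iso.
  - by do 2!congr inr; apply: val_inj.
  - by do 2!congr inr; apply: val_inj.
  - by do 2!congr inr; apply: val_inj.
  - by do 2!congr inr; apply: val_inj.
have name_surj l : exists i, isomorphic_alg (nil3_alg l) (nil3_alg (name i)).
  have refl l' i :
      name i = l' -> exists i, isomorphic_alg (nil3_alg l') (nil3_alg (name i)).
    by move=> <-; exists i, idfun; split; [exact: (Bijective (g := idfun)) | ].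
  case: l => [||d d0|d||].
  - exact: (refl _ (inr (inr (@Ordinal 4 0 isT)))).
  - exact: (refl _ (inr (inr (@Ordinal 4 1 isT)))).
  - have [i [t [t0 def_d]]] := u_surj d d0; exists (inr (inl i)).
    exact: A33_isomorphic def_d.
  - have lt_d : (seq.index d s < q)%N by rewrite -sz_s index_mem all_s.
    by apply: (refl _ (inl (Ordinal lt_d))); rewrite /= nth_index ?all_s.
  - exact: (refl _ (inr (inr (@Ordinal 4 2 isT)))).
  - exact: (refl _ (inr (inr (@Ordinal 4 3 isT)))).
exists (fun i => nil3_alg (name (index i))); split=> [|A nilA].
  split=> [i|i j /= /name_inj/(can_inj indexK) //]; exact: nil3_alg_is_nil3.
have [l iso_l] := nil3_classification nilA; have [i iso_i] := name_surj l.
by exists (unindex i); rewrite /= unindexK; apply: isomorphic_alg_trans iso_i.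
Qed.

(** Half of the powers of a generator are squares when the multiplicative group
    has even order [q.-1], all of them when this order is odd. *)
Lemma number_of_nil3_classes_odd : odd q -> number_of_nil3_classes F (q + 6).
Proof.
move=> odd_q; have [z prim_z gen_z] := finite_field_generator.
have z0 : z != 0.
  by rewrite (prim_root_eq0 prim_z) -lt0n (prim_order_gt0 prim_z).
have nonsquare t : z <> t ^+ 2.
  move=> def_z; have t0 : t != 0.
    by apply: contraNneq z0 => t0; rewrite def_z t0 expr0n.
  have [i def_t] := gen_z t t0.
  have even_n : (2 %| q.-1)%N by case: (q) odd_q => // n; rewrite dvdn2.
  move/eqP: def_z; rewrite def_t -exprM -{1}[z]expr1 (eq_prim_root_expr prim_z).
  move/eqP/(congr1 (modn^~ 2)); rewrite !modn_dvdm // !modn2 oddM andbF.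
  by [].
pose u (i : 'I_2) : F := if i == 0 then 1 else z.
apply: (@number_of_nil3_classes_square_classes 2 u).
- by move=> i; rewrite /u; case: ifP; rewrite ?oner_eq0.
- move=> [[|[|//]] lt_i] [[|[|//]] lt_j] t; rewrite /u /= => def_u;
    try exact: val_inj.
    case: (nonsquare t^-1); have t0 : t != 0.
      apply: contraTneq (oner_neq0 F) => t0.
      by rewrite def_u t0 expr0n mul0r eqxx.
    by rewrite exprVn -[LHS](mulKf (expf_neq0 2 t0)) -def_u mulr1.
  by case: (nonsquare t); rewrite def_u mulr1.
- move=> d /gen_z[i ->]; exists (if odd i then 1 else 0), (z ^+ i./2).
  split; first exact: expf_neq0.
  rewrite -exprM muln2 -{1}[i]odd_double_half exprD mulrC /u.
  by case: (odd i).
Qed.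

Lemma number_of_nil3_classes_even :
  ~~ odd q -> number_of_nil3_classes F (q + 5).
Proof.
move=> even_q; have [z prim_z gen_z] := finite_field_generator.
have z0 : z != 0.
  by rewrite (prim_root_eq0 prim_z) -lt0n (prim_order_gt0 prim_z).
apply: (@number_of_nil3_classes_square_classes 1 (fun=> 1)).
- by move=> _; apply: oner_neq0.
- by move=> i j *; rewrite !ord1.
move=> d /gen_z[i ->]; exists ord0.
(* Adding the odd order of the group to an odd exponent makes it even. *)
pose j := (i + odd i * q.-1)%N.
have -> : z ^+ i = z ^+ j.
  by rewrite /j exprD mulnC exprM (prim_expr_order prim_z) expr1n mulr1.
have even_j : ~~ odd j.
  have := prim_order_gt0 prim_z; rewrite /j oddD oddM oddb.
  by case: (q) even_q => //= n /negPn ->; rewrite andbT addbb.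
exists (z ^+ j./2); split; first exact: expf_neq0.
by rewrite mulr1 -exprM muln2 even_halfK.
Qed.

End FiniteField.

Lemma infinitely_many_nil3_classes_infinite :
  infinite_set [set: F] -> infinitely_many_nil3_classes F.
Proof.
pose pF : pointedType := HB.pack F (isPointed.Build F 0).
move=> /infiniteP/(@pcard_injP _ pF)[f f_inj].
exists (fun n => A34 (f n : F)); split=> [n|m n].
  exact: (nil3_alg_is_nil3 (N34 (f n : F))).
by move/A34_isomorphic_eq/f_inj; apply; rewrite in_setT.
Qed.

End Counting.

(** * The classification *)

Theorem mainTheorem2 (F : fieldType) :
  (forall A : assocAlgType F, is_nil3 A ->
     exists l : nil3_name F, isomorphic_alg A (nil3_alg l)) /\
  (forall l l' : nil3_name F, l <> l' ->
     isomorphic_alg (nil3_alg l) (nil3_alg l') ->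
     exists (d e : F) (hd : d != 0) (he : e != 0),
       l = N33 hd /\ l' = N33 he) /\
  (forall d e : F, d != 0 -> e != 0 ->
     (isomorphic_alg (A33 d) (A33 e) <->
      exists y : F, y != 0 /\ d = y ^+ 2 * e)) /\
  (infinite_set [set: F] -> infinitely_many_nil3_classes F) /\
  (forall q : nat, [set: F] #= `I_q -> odd q ->
     number_of_nil3_classes F (q + 6)%N) /\
  (forall q : nat, [set: F] #= `I_q -> ~~ odd q ->
     number_of_nil3_classes F (q + 5)%N).
Proof.
split; first exact: nil3_classification.
split; first exact: nil3_isomorphic_names.
split.
  move=> d e d0 _; split=> [|[y [y0 def_d]]]; last exact: A33_isomorphic def_d.
  by case/(A33_isomorphic_square d0) => y y0 ->; exists y.
split; first exact: infinitely_many_nil3_classes_infinite.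
split=> q.
  exact: number_of_nil3_classes_odd.
exact: number_of_nil3_classes_even.
Qed.
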